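(* Let $d, n \in \mathbb{N}$ with $n \ge 1$, let $\{\chi_{\bm{s}} : \bm{s} \in \mathbb{R}^d\}$ be an isotropic functional random field with values in $\mathcal{H} = L^2([0,1])$ and trace-covariogram $h \mapsto \sigma_{\mathrm{tr}}(h)$, where $\sigma_{\mathrm{tr}}(0) > 0$, and consider a sample $\chi_{\bm{s}_1}, \dots, \chi_{\bm{s}_n}$ of this field at locations $\bm{s}_1, \dots, \bm{s}_n \in \mathbb{R}^d$. Let $$\mathrm{ESS}_{\mathcal{F}} = n^2\, \sigma_{\mathrm{tr}}(0) \left( \sum_{i=1}^n \sum_{j=1}^n \sigma_{\mathrm{tr}}(\|\bm{s}_i - \bm{s}_j\|) \right)^{-1}$$ be the functional effective sample size. Suppose that $\sigma_{\mathrm{tr}}(h) \ge 0$ for all $h \ge 0$. Then $$1 \le \mathrm{ESS}_{\mathcal{F}} \le n.$$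
   Context: Let $\mathcal{H} = L^2([0,1])$ be the real Hilbert space with inner product $\langle f, g\rangle = \int_0^1 f(t) g(t)\,dt$ and norm $\|f\|_{\mathcal{H}} = \langle f,f\rangle^{1/2}$; $\|\cdot\|$ denotes the Euclidean norm on $\mathbb{R}^d$. A functional random field on $\mathbb{R}^d$ is a collection $\{\chi_{\bm{s}} : \bm{s} \in \mathbb{R}^d\}$ of $\mathcal{H}$-valued random variables. When $E[\|\chi_{\bm{s}}\|_{\mathcal{H}}] < \infty$, the mean function $\mu_{\bm{s}} \in \mathcal{H}$ is defined by $E[\langle \chi_{\bm{s}}, f\rangle] = \langle \mu_{\bm{s}}, f\rangle$ for all $f \in \mathcal{H}$. When $E[\|\chi_{\bm{s}}\|_{\mathcal{H}}^2] < \infty$ for all $\bm{s}$, the covariance operators are $C_{\bm{s}_1,\bm{s}_2}(f) = E[\langle \chi_{\bm{s}_1} - \mu_{\bm{s}_1}, f\rangle (\chi_{\bm{s}_2} - \mu_{\bm{s}_2})]$, $f \in \mathcal{H}$. The field is weakly stationary if $E[\|\chi_{\bm{s}}\|_{\mathcal{H}}^2] < \infty$ for all $\bm{s}$, $\mu_{\bm{s}} = \mu$ does not depend on $\bm{s}$, and $C_{\bm{s}_1,\bm{s}_2}$ depends on $\bm{s}_1,\bm{s}_2$ only through $\bm{s}_1 - \bm{s}_2$; it is isotropic if it is weakly stationary and $C_{\bm{s}_1,\bm{s}_2}$ depends on $\bm{s}_1,\bm{s}_2$ only through $\|\bm{s}_1 - \bm{s}_2\|$. The operator $C_{\bm{s}_1,\bm{s}_2}$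 has kernel $\sigma_{\bm{s}_1,\bm{s}_2}(t,u) = \mathrm{cov}[\chi_{\bm{s}_1}(t), \chi_{\bm{s}_2}(u)]$. The trace-covariogram is $$\sigma_{\mathrm{tr}}(\bm{s}_1,\bm{s}_2) = E[\langle \chi_{\bm{s}_1} - \mu_{\bm{s}_1}, \chi_{\bm{s}_2} - \mu_{\bm{s}_2}\rangle] = \int_0^1 \sigma_{\bm{s}_1,\bm{s}_2}(t,t)\,dt,$$ which under isotropy depends only on $h = \|\bm{s}_1 - \bm{s}_2\|$ and is written $\sigma_{\mathrm{tr}}(h)$. *)

(* Defs.v *)
From mathcomp Require Import all_boot all_order all_algebra.
From mathcomp Require Import all_classical all_reals all_analysis.

Set Implicit Arguments.
Unset Strict Implicit.
Unset Printing Implicit Defensive.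

Import Order.TTheory GRing.Theory Num.Theory.

Local Open Scope classical_set_scope.
Local Open Scope ring_scope.

Section hilbert_space.
Context {R : realType}.

(* Restricting the measure to [0, 1] identifies functions on R that agree
   almost everywhere on [0, 1], so that the quotient is L^2([0, 1]). *)
Definition lebesgue01 : {measure set (measurableTypeR R) -> \bar R} :=
  mrestr (@lebesgue_measure R) (measurable_itv `[0, 1]%R).

Definition L2 := LspaceType2 lebesgue01.

(* The inner product and the norm only depend on the classes of f and g modulo
   almost everywhere equality. They are stated on functions because the quotient
   type carries no vector space structure: below, the function f - g
   represents the difference of two elements f and g of L2. *)
Definition inner (f g : R -> R) : R := \int[lebesgue01]_t (f t * g t).

Definition hnorm (f : R -> R) : R := Num.sqrt (inner f f).

Definition L2_open : set (set L2) := [set U | forall f : L2, U f ->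
  exists2 e : R, 0 < e & forall g : L2, hnorm (g \- f) < e -> U g].

Definition L2_borel : set (set L2) := <<s L2_open >>.

End hilbert_space.
Arguments L2 : clear implicits.

(* Euclidean norm: the norm `|x| of the library on row vectors is the sup norm. *)
Definition enorm (R : realType) (d : nat) (x : 'rV[R]_d) : R :=
  Num.sqrt (\sum_(i < d) x ord0 i ^+ 2).

Section functional_random_field.
Context {dO : measure_display} {Omega : measurableType dO} {R : realType}.
Variable P : probability Omega R.

(* The expectation of a random element X of L2 (given by representatives) is
   the element m of L2 with E<X, f> = <m, f> for all f in L2. *)
Definition is_L2_expectation (X : Omega -> R -> R) (m : L2 R) :=
  forall f : L2 R, 'E_P[fun w => inner (X w) f]%E = (inner m f)%:E.

Section field.
Context {d : nat}.
Variables (chi : 'rV[R]_d -> Omega -> L2 R) (mu : 'rV[R]_d -> L2 R).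
Variable C : 'rV[R]_d -> 'rV[R]_d -> L2 R -> L2 R.

Definition functional_random_field := forall s (A : set (L2 R)),
  L2_borel A -> measurable (chi s @^-1` A).

Definition centered s (w : Omega) : R -> R := chi s w \- mu s.

Definition mean_functions := forall s, is_L2_expectation (chi s) (mu s).

Definition covariance_operators := forall s1 s2 (f : L2 R),
  is_L2_expectation
    (fun w t => inner (centered s1 w) f * centered s2 w t) (C s1 s2 f).

Definition weakly_stationary :=
  [/\ forall s, ('E_P[fun w => (hnorm (chi s w) ^+ 2)%R] < +oo)%E,
      forall s s', mu s = mu s' &
      forall s1 s2 s1' s2', s1 - s2 = s1' - s2' -> C s1 s2 = C s1' s2'].

Definition isotropic := weakly_stationary /\
  forall s1 s2 s1' s2', enorm (s1 - s2) = enorm (s1' - s2') ->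
    C s1 s2 = C s1' s2'.

Definition trace_covariogram s1 s2 : R :=
  fine 'E_P[fun w => inner (centered s1 w) (centered s2 w)]%E.

(* The value sigma_tr(h) shared, under isotropy, by all the pairs of locations
   at distance h (and 0 if there is none, i.e. if h < 0, or if d = 0 < h). *)
Definition sigma_tr (h : R) : R := xget 0
  [set c | exists s1 s2, enorm (s1 - s2) = h /\ c = trace_covariogram s1 s2].

Definition ESS (n : nat) (s : 'I_n -> 'rV[R]_d) : R :=
  n%:R ^+ 2 * sigma_tr 0 *
  (\sum_(i < n) \sum_(j < n) sigma_tr (enorm (s i - s j)))^-1.

End field.
End functional_random_field.

(* Main.v *)
(* Since the diagonal terms of the double sum are sigma_tr(0) and the others are
   nonnegative, the sum is at least n sigma_tr(0), whence ESS <= n. For 1 <= ESS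
   one needs sigma_tr(h) <= sigma_tr(0), which follows from
   2 <X, Y> <= |X|^2 + |Y|^2 once E|chi_s - mu_s|^2 is known not to depend on s.
   This expectation is the trace of C s s; instead of an orthonormal basis, we
   use the averages of a function over the N + 1 equal subintervals of [0, 1]:
   their squared norm is a finite combination of squares of inner products, so
   that its expectation is determined by C s s. It is at most the squared norm
   of the function, and by the Lebesgue differentiation theorem and Fatou's
   lemma its limit inferior is at least that squared norm. *)

From HB Require Import structures.
Require Import Defs.
From mathcomp Require Import all_boot all_order all_algebra.
From mathcomp Require Import all_classical all_reals all_analysis.
From mathcomp Require Import measurable_realfun ring lra.

Set Implicit Arguments.
Unset Strict Implicit.
Unset Printing Implicit Defensive.

Import Order.TTheory GRing.Theory Num.Theory.
Import numFieldNormedType.Exports.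

Local Open Scope classical_set_scope.
Local Open Scope ring_scope.

(** * Square-integrable functions on [0, 1] and their inner product *)

Section inner_product.
Context {R : realType}.
Local Notation m := (@lebesgue01 R).
Local Notation L2fun := (Lfun m 2%:E).
Implicit Types f g h : R -> R.

Lemma lebesgue01T : m setT = 1%E.
Proof.
rewrite /= /mrestr setTI lebesgue_measure_itv /= lte_fin ltr01.
by rewrite oppr0 adde0.
Qed.

Lemma L2_Lfun (f : L2 R) : (f : R -> R) \in L2fun.
Proof.
have mf : measurable_fun setT (f : R -> R).
  by case: f => f ?; exact: (@measurable_funPT _ _ _ _ (repr f)).
rewrite inE; apply/andP; split; rewrite inE //=.
exact: (@Lebesgue_finite _ _ _ _ _ _ f).
Qed.

Lemma LfunD f g : f \in L2fun -> g \in L2fun -> (f \+ g) \in L2fun.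
Proof.
have [_ addL] := Lfun_addr_closed m (lee1n 2); exact: addL.
Qed.

Lemma LfunZ (a : R) f : f \in L2fun -> (fun t => a * f t) \in L2fun.
Proof.
move=> fL; rewrite (_ : (fun t => _) = a \o* f).
  exact: (@Lfun_scale _ _ _ m f a 2 (ler1n _ 2)).
by apply/funext => t /=; rewrite mulrC.
Qed.

Lemma LfunB f g : f \in L2fun -> g \in L2fun -> (f \- g) \in L2fun.
Proof.
move=> fL gL; rewrite (_ : f \- g = f \+ (fun t => -1 * g t)).
  exact/LfunD/LfunZ.
by apply/funext => t /=; rewrite mulN1r.
Qed.

Lemma Lfun_indic (A : set R) : measurable A -> \1_A \in L2fun.
Proof.
move=> mA.
rewrite inE; apply/andP; split; rewrite inE /=; first exact: measurable_indic.
rewrite /finite_norm unlock /Lnorm poweR_lty //.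
apply: (@le_lt_trans _ _ (\int[m]_x (cst 1%E x))%E).
  apply: ge0_le_integral => //=.
  - apply/measurable_EFinP; apply: (measurableT_comp (measurable_powR _)).
    by apply: measurableT_comp => //; exact: measurable_indic.
  - move=> t _; rewrite lee_fin indicE.
    by case: (t \in A); rewrite ?normr1 ?normr0 ?powR1 ?powR0.
by rewrite integral_cst // lebesgue01T mul1e ltry.
Qed.

Lemma inner_integrable f g : f \in L2fun -> g \in L2fun ->
  m.-integrable setT (EFin \o (fun t => f t * g t)).
Proof. by move=> fL gL; apply/Lfun1_integrable/Lfun2_mul_Lfun1. Qed.

Lemma Lfun_integrable01 f : f \in L2fun -> m.-integrable setT (EFin \o f).
Proof. by move=> fL; apply/Lfun1_integrable/Lfun_subset12; rewrite ?lebesgue01T. Qed.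

Lemma innerC f g : inner f g = inner g f.
Proof. by apply: eq_Rintegral => t _; rewrite mulrC. Qed.

Lemma innerDl f g h : f \in L2fun -> g \in L2fun -> h \in L2fun ->
  inner (f \+ g) h = inner f h + inner g h.
Proof.
move=> fL gL hL; rewrite /inner -RintegralD //; do ? exact: inner_integrable.
by apply: eq_Rintegral => t _ /=; rewrite mulrDl.
Qed.

Lemma innerZl (a : R) f h : f \in L2fun -> h \in L2fun ->
  inner (fun t => a * f t) h = a * inner f h.
Proof.
move=> fL hL; rewrite /inner -RintegralZl //; last exact: inner_integrable.
by apply: eq_Rintegral => t _ /=; rewrite mulrA.
Qed.

Lemma innerBl f g h : f \in L2fun -> g \in L2fun -> h \in L2fun ->
  inner (f \- g) h = inner f h - inner g h.
Proof.
move=> fL gL hL; rewrite /inner -RintegralB //; do ? exact: inner_integrable.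
by apply: eq_Rintegral => t _ /=; rewrite mulrBl.
Qed.

Lemma inner_ge0 f : 0 <= inner f f.
Proof. by apply: Rintegral_ge0 => t _; rewrite -expr2 sqr_ge0. Qed.

(** For well-chosen [a], the nonnegativity of this expansion plays the part of the Cauchy-Schwarz
    inequality below. *)
Lemma inner_sqrD (a : R) f g : f \in L2fun -> g \in L2fun ->
  inner (fun t => a * f t + g t) (fun t => a * f t + g t) =
  a ^+ 2 * inner f f + 2 * a * inner f g + inner g g.
Proof.
move=> fL gL; have aL := LfunZ a fL; have sL := LfunD aL gL.
rewrite (innerDl aL gL sL) (innerZl _ fL sL).
rewrite (innerC f) (innerC g) !(innerDl aL gL) // !innerZl //.
by rewrite (innerC g f); ring.
Qed.

Lemma EFin_inner f g : f \in L2fun -> g \in L2fun ->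
  (inner f g)%:E = (\int[m]_t (f t * g t)%:E)%E.
Proof.
move=> fL gL; rewrite /inner /Rintegral fineK //.
exact/integrable_fin_num/inner_integrable.
Qed.

(** Covariance operators act on elements of [L2]; this allows them to be tested on concrete
    functions such as indicators. *)
Lemma L2_repr f : f \in L2fun ->
  exists e : L2 R, (e : R -> R) = f %[ae m].
Proof.
move=> fL.
have mf : measurable_fun setT (f : measurableTypeR R -> measurableTypeR R).
  by move/sub_Lfun_mfun: (fL); rewrite inE.
pose f0 : {mfun measurableTypeR R >-> measurableTypeR R} :=
  HB.pack f (isMeasurableFun.Build _ _ (measurableTypeR R) (measurableTypeR R) f mf).
(* Reading the class [q] as a function means taking its canonical representative, known to agree
   with [f] only almost everywhere. *)
pose q : {mfun_ m, measurableTypeR R >-> measurableTypeR R} :=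
  (\pi_(aeEqMfun (measurableTypeR R) m) f0)%qT.
have qf : (q : R -> R) = f %[ae m].
  have /eqmodP : (repr q = f0 %[mod (aeEqMfun (measurableTypeR R) m)])%qT.
    by rewrite reprK.
  by move/asboolP.
have mq : measurable_fun setT (q : R -> R).
  exact: (@measurable_funPT _ _ _ _ (repr q)).
have qfin : finite_norm m 2 q.
  move/sub_Lfun_finLfun: fL; rewrite inE /= /finite_norm unlock /Lnorm.
  rewrite (ae_eq_integral (fun t => `|(q t)%:E| `^ 2)%E) //.
  - apply/measurable_EFinP; apply: (measurableT_comp (measurable_powR _)).
    exact: measurableT_comp.
  - apply/measurable_EFinP; apply: (measurableT_comp (measurable_powR _)).
    exact: measurableT_comp.
  - by apply: (@filterS _ _ (ae_filter_ringOfSetsType m) _ _ _ qf) => t /= -> //.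
pose Q : L2 R := HB.pack q (isFinLebesgue.Build _ _ _ m 2%:E (lee1n 2) q qfin).
by exists Q.
Qed.

Lemma inner_ae f g h : g \in L2fun -> h \in L2fun -> f \in L2fun ->
  g = h %[ae m] -> inner f g = inner f h.
Proof.
move=> gL hL fL gh; rewrite /inner /Rintegral; congr fine.
apply: ae_eq_integral => //.
- exact: (measurable_int m (inner_integrable fL gL)).
- exact: (measurable_int m (inner_integrable fL hL)).
- by apply: (@filterS _ _ (ae_filter_ringOfSetsType m) _ _ _ gh) => t /= -> //.
Qed.

End inner_product.

(** * Equal subintervals and the energy of a function *)

Section cells.
Context {R : realType}.
Local Notation mu := (@lebesgue_measure R).
Local Notation m := (@lebesgue01 R).
Local Notation L2fun := (Lfun m 2%:E).
Implicit Types (N : nat) (k : int) (t : R) (x : R -> R).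

(** Half-open, so that the cells of a given [N] are disjoint and [Num.floor] finds the cell of a
    point. With integer indices they cover the whole line; the indices 0 to [N] cover [0, 1[. *)
Definition cell N k : set R :=
  `[k%:~R / N.+1%:R, (k + 1)%:~R / N.+1%:R[%classic.

Lemma measurable_cell N k : measurable (cell N k).
Proof. exact: measurable_itv. Qed.

Lemma cellE N k t : (t \in cell N k) = (Num.floor (N.+1%:R * t) == k).
Proof.
rewrite floor_eq /cell mem_setE in_itv /= ler_pdivrMr ?ltr0n //.
by rewrite ltr_pdivlMr ?ltr0n // (mulrC t).
Qed.

Lemma lebesgue_cell N k : mu (cell N k) = (N.+1%:R^-1)%:E.
Proof.
rewrite /cell lebesgue_measure_itv /= lte_fin ltr_pM2r ?invr_gt0 ?ltr0n //.
rewrite ltr_int ltrDl ltr01 -EFinB -mulrBl -rmorphB /=.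
by rewrite addrAC subrr add0r mul1r.
Qed.

Lemma cell_sub01 N (i : 'I_N.+1) : cell N i%:Z `<=` `[0, 1].
Proof.
move=> t; rewrite /cell /= !in_itv /= => /andP[it ti]; apply/andP; split.
  by apply: le_trans it; rewrite divr_ge0 // ler0z.
apply: le_trans (ltW ti) _; rewrite ler_pdivrMr ?ltr0n // mul1r.
by rewrite -PoszD addn1 -pmulrn ler_nat ltn_ord.
Qed.

Lemma lebesgue01_cell N (i : 'I_N.+1) : m (cell N i%:Z) = (N.+1%:R^-1)%:E.
Proof.
by rewrite /= /mrestr setIidl ?lebesgue_cell //; exact: cell_sub01.
Qed.

(** Prepares for Lebesgue differentiation, which concerns Lebesgue measure on the whole line: hence
    the change of measure and the extension of [x] by zero. *)
Lemma inner_indic_cell x N (i : 'I_N.+1) :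
  inner x \1_(cell N i%:Z) = \int[mu]_(t in cell N i%:Z) (x \_ `[0, 1]) t.
Proof.
have -> : inner x \1_(cell N i%:Z) = \int[m]_(t in cell N i%:Z) x t.
  rewrite Rintegral_mkcond; apply: eq_Rintegral => t _.
  rewrite /patch indicE; case: (_ \in _); rewrite ?mulr1 // mulr0.
  exact: erefl.
rewrite /Rintegral; congr fine.
transitivity (\int[mu]_(t in cell N i%:Z) (x t)%:E)%E.
  apply: eq_measure_integral => A mA Ac.
  by rewrite /= /mrestr setIidl //; exact: (subset_trans Ac (@cell_sub01 _ _)).
apply: eq_integral => t; rewrite inE => /cell_sub01 t01.
by rewrite /patch mem_set.
Qed.

Lemma inner_indic_cell_sqr N (i : 'I_N.+1) :
  inner (\1_(cell N i%:Z)) \1_(cell N i%:Z) = N.+1%:R^-1 :> R.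
Proof.
transitivity (\int[m]_t (\1_(cell N i%:Z) t)).
  apply: eq_Rintegral => t _; rewrite indicE.
  by case: (_ \in _); rewrite ?mulr1 ?mulr0.
rewrite /Rintegral integral_indic ?setIT //; last exact: measurable_cell.
by rewrite lebesgue01_cell.
Qed.

(* The squared L^2-norm of the function obtained by averaging x on each of the
   N + 1 cells of [0, 1]: each average is N + 1 times an inner product, and each
   cell has length 1 / (N + 1). *)
Definition energy N x : R :=
  \sum_(i < N.+1) N.+1%:R * inner x \1_(cell N i%:Z) ^+ 2.

(** On a cell where [x] has average b, (x - b)^2 >= 0 gives 2 b x - b^2 <= x^2. The integral of the
    left side over the cell is the corresponding term of the energy. *)
Lemma energy_le N x : x \in L2fun -> energy N x <= inner x x.
Proof.
move=> xL; rewrite -lee_fin EFin_inner //.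
pose u (i : 'I_N.+1) : R -> R := \1_(cell N i%:Z).
have uL i : u i \in L2fun by apply: Lfun_indic; exact: measurable_cell.
pose b i := N.+1%:R * inner x (u i).
(* This is 2 b x - b^2 on the cell [i] and 0 elsewhere. *)
pose F i t := 2 * b i * (x t * u i t) - b i ^+ 2 * (u i t * u i t).
have iF1 i : m.-integrable setT (EFin \o (fun t => 2 * b i * (x t * u i t))).
  exact: (integrableZl measurableT (2 * b i) (inner_integrable xL (uL i))).
have iF2 i : m.-integrable setT (EFin \o (fun t => b i ^+ 2 * (u i t * u i t))).
  exact: (integrableZl measurableT (b i ^+ 2) (inner_integrable (uL i) (uL i))).
have iF i : m.-integrable setT (EFin \o F i).
  exact: (integrableB measurableT (iF1 i) (iF2 i)).
have intF i : (\int[m]_t (F i t)%:E)%E = (N.+1%:R * inner x (u i) ^+ 2)%:E.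
  rewrite -[LHS]fineK; last exact: (integrable_fin_num measurableT (iF i)).
  congr (_ %:E); transitivity (\int[m]_t (2 * b i * (x t * u i t) -
    b i ^+ 2 * (u i t * u i t))) => //; rewrite RintegralB //.
  rewrite !RintegralZl //; [|exact: inner_integrable..].
  rewrite -/(inner x (u i)) -/(inner (u i) (u i)) inner_indic_cell_sqr /b.
  by field; rewrite gt_eqF // ltr_pwDl.
rewrite /energy -sumEFin.
under eq_bigr => i _ do rewrite -intF.
rewrite -integral_sum //; apply: le_integral => //.
- by apply: integrable_sum => // i _; exact: iF.
- exact: inner_integrable.
move=> t _; rewrite sumEFin lee_fin /F.
(* By disjointness at most one [F i t] is nonzero; outside all these cells the sum is 0. *)
have [k kt|nk] := pickP (fun i : 'I_N.+1 => t \in cell N i%:Z).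
  rewrite (bigD1 k) //= big1 ?addr0 => [|i ik].
    by rewrite /u indicE kt !mulr1 -subr_ge0; have := sqr_ge0 (x t - b k); nra.
  rewrite /u indicE (_ : (t \in _) = false) ?mulr0 ?subr0 //.
  apply: contraNF ik; rewrite cellE in kt *; rewrite cellE (eqP kt) eqz_nat.
  by rewrite eq_sym.
rewrite big1 => [|i _]; first by rewrite -expr2 sqr_ge0.
by rewrite /u indicE nk !mulr0 subr0.
Qed.

End cells.

(** * Limits inferior of extended real sequences *)

Section limn_einf_lemmas.
Context {R : realType}.
Local Open Scope ereal_scope.

Lemma limn_einf_ge0 (u : (\bar R)^nat) :
  (forall n, 0 <= u n) -> 0 <= limn_einf u.
Proof.
move=> u0; rewrite limn_einf_lim; apply: lime_ge; first exact: is_cvg_einfs.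
by apply: nearW => n; apply: le_ereal_inf_tmp => _ [k _ <-].
Qed.

Lemma limn_einf_le (u : (\bar R)^nat) (l : \bar R) :
  (forall n, u n <= l) -> limn_einf u <= l.
Proof.
move=> ul; rewrite limn_einf_lim; apply: lime_le; first exact: is_cvg_einfs.
apply: nearW => n; apply: le_trans (ul n); apply: ereal_inf_lbound.
by exists n => /=.
Qed.

Lemma measurable_fun_limn_einf d (T : measurableType d) (f : (T -> \bar R)^nat) :
  (forall n, measurable_fun setT (f n)) ->
  measurable_fun setT (fun t => limn_einf (f^~ t)).
Proof.
move=> mf.
apply: (@emeasurable_fun_cvg _ _ _ _ (fun n t => einfs (f^~ t) n)) => [n|t _].
  exact: measurable_fun_einfs.
by rewrite limn_einf_lim; apply: is_cvg_einfs.
Qed.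

End limn_einf_lemmas.

(** * Convergence of the energies to the squared norm *)

Section energy_limit.
Context {R : realType}.
Local Notation mu := (@lebesgue_measure R).
Local Notation m := (@lebesgue01 R).
Local Notation L2fun := (Lfun m 2%:E).
Implicit Types (N : nat) (t : R) (x : R -> R).

Lemma nicely_shrinking_cell t :
  nicely_shrinking t (fun N => cell N (Num.floor (N.+1%:R * t))).
Proof.
split=> [N|]; first exact: measurable_cell.
have r_gt0 N : 0 < N.+1%:R^-1 :> R by rewrite invr_gt0.
(* The cell of [t] lies in the ball of radius 1 / (N + 1) around [t], whose length is twice that of
   the cell: hence the constant 2. *)
exists (2, fun N => PosNum (r_gt0 N)); split => //=.
- exact: cvg_harmonic.
- move=> N y /mem_set; rewrite cellE floor_eq => /andP[y1 y2].
  have := floor_itv (N.+1%:R * t); rewrite !intrD => /andP[t1 t2].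
  have N0 : 0 < N.+1%:R :> R by [].
  rewrite /ball /= -(ltr_pM2l N0) divff ?gt_eqF // -[X in X * _]ger0_norm //.
  rewrite -normrM mulrBr ltr_norml; move: y1 y2; rewrite intrD; lra.
move=> N; rewrite lebesgue_measure_ball // lebesgue_cell -EFinM lee_fin.
by rewrite mulr_natl.
Qed.

Lemma ae_lebesgue01 (P : R -> Prop) :
  {ae mu, forall t, P t} -> {ae m, forall t, P t}.
Proof.
move=> [A [mA A0 PA]]; exists A; split => //.
apply/eqP; rewrite eq_le measure_ge0 andbT -[leRHS]A0 /= /mrestr.
by apply: le_measure; rewrite ?inE //; apply: measurableI.
Qed.

(** Every point of [0, 1[ lies in a cell of index 0 to [N]; the point 1 does not, but it forms a
    null set. *)
Lemma ae_lebesgue01_co : {ae m, forall t, `[0, 1[%classic t}.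
Proof.
exists (~` `[0, 1[); split => //; first by apply: measurableC; exact: measurable_itv.
apply/eqP; rewrite eq_le measure_ge0 andbT /= /mrestr.
rewrite -(lebesgue_measure_set1 (1 : R)); apply: le_measure; rewrite ?inE //.
  by apply: measurableI; [exact: measurableC|].
move=> t [/= /negP]; rewrite !in_itv /= negb_and -leNgt => + /andP[t0 t1].
by rewrite t0 /= => t1'; apply/eqP; rewrite eq_le t1 t1'.
Qed.

Lemma integrable_restrict01 x : x \in L2fun ->
  mu.-integrable setT (EFin \o x \_ `[0, 1]).
Proof.
move=> xL; rewrite -restrict_EFin; apply: (integrable_mkcond _ _).1 => //.
have /integrableP[mx xfin] := Lfun_integrable01 xL.
apply/integrableP; split; first exact: measurable_funTS.
rewrite -(@eq_measure_integral _ _ _ _ mu m); last first.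
  by move=> A mA A01; rewrite /= /mrestr setIidl.
apply: le_lt_trans xfin; apply: ge0_subset_integral => //.
exact: measurableT_comp.
Qed.

(** For [t] in [0, 1[, the mean of [x] over the cell containing [t]. *)
Definition average N x t :=
  N.+1%:R * inner x \1_(cell N (Num.floor (N.+1%:R * t))).

Lemma floor_co N t : `[0, 1[%classic t ->
  exists i : 'I_N.+1, Num.floor (N.+1%:R * t) = i%:Z.
Proof.
rewrite /= in_itv /= => /andP[t0 t1].
have f0 : (0 <= Num.floor (N.+1%:R * t))%R by rewrite floor_ge0 mulr_ge0.
have fN : (Num.floor (N.+1%:R * t) < N.+1%:Z)%R.
  by rewrite floor_lt_int -pmulrn gtr_pMr.
case: (Num.floor _) f0 fN => // k _ kN.
by exists (Ordinal (kN : (k < N.+1)%N)).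
Qed.

(** The cells containing [t] shrink nicely to [t], so Lebesgue differentiation applies to [x]
    extended by zero. *)
Lemma average_cvg x : x \in L2fun ->
  {ae m, forall t, average N x t @[N --> \oo] --> x t}.
Proof.
move=> xL; have ix := integrable_restrict01 xL.
have locx : locally_integrable setT (x \_ `[0, 1]).
  by apply: open_integrable_locally; [exact: openT|exact: ix].
apply: (@filterS2 _ _ (ae_filter_ringOfSetsType m) _ _ _ _ ae_lebesgue01_co
  (ae_lebesgue01 (lebesgue_differentiation locx))) => t /= t01 xt.
have := nice_lebesgue_differentiation nicely_shrinking_cell locx xt.
rewrite {2}/patch ifT; last first.
  by rewrite inE /=; move: t01; rewrite !in_itv /= => /andP[-> /ltW].
move=> /fine_cvgP[_]; apply: cvg_trans; apply: near_eq_cvg.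
apply: nearW => N /=.
have [i it] := floor_co N t01.
rewrite /average it inner_indic_cell lebesgue_cell inver gt_eqF //= invrK.
rewrite fineM //; apply: integrable_fin_num; first exact: measurable_cell.
by apply: integrableS ix => //; exact: measurable_cell.
Qed.

(** The energy is the integral of [h N], the square of the averaged function, and [h N t] tends to
    x(t)^2 almost everywhere; Fatou's lemma concludes. *)
Lemma inner_le_limn_einf_energy x : x \in L2fun ->
  ((inner x x)%:E <= limn_einf (fun N => (energy N x)%:E))%E.
Proof.
move=> xL; rewrite EFin_inner //.
pose u N (i : 'I_N.+1) : R -> R := \1_(cell N i%:Z).
pose h N t := \sum_(i < N.+1) (N.+1%:R * inner x (u N i)) ^+ 2 * u N i t.
have h0 N t : 0 <= h N t.
  by apply: sumr_ge0 => i _; rewrite mulr_ge0 ?sqr_ge0 // /u indicE.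
have mhi N i : measurable_fun setT
    (fun t => ((N.+1%:R * inner x (u N i)) ^+ 2 * u N i t)%:E).
  apply/measurable_EFinP/measurable_funM => //.
  by apply: measurable_indic; exact: measurable_cell.
have mh N : measurable_fun setT (fun t => (h N t)%:E).
  under eq_fun do rewrite -sumEFin.
  exact: emeasurable_sum.
have inth N : (\int[m]_t (h N t)%:E)%E = (energy N x)%:E.
  under eq_integral => t _ do rewrite -sumEFin.
  rewrite (ge0_integral_sum m measurableT (mhi N)) => [|i t _]; last first.
    by rewrite lee_fin mulr_ge0 ?sqr_ge0 // /u indicE.
  rewrite /energy -sumEFin; apply: eq_bigr => i _.
  under eq_integral do rewrite EFinM.
  rewrite ge0_integralZl //; first last.
  - by rewrite lee_fin sqr_ge0.
  - by move=> t _; rewrite lee_fin /u indicE.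
  - by apply/measurable_EFinP/measurable_indic; exact: measurable_cell.
  rewrite integral_indic ?setIT //; last exact: measurable_cell.
  rewrite lebesgue01_cell -EFinM; congr (_ %:E).
  by rewrite /u; field; rewrite gt_eqF // ltr_pwDl.
under [X in limn_einf X]eq_fun do rewrite -inth.
apply: le_trans (fatou m measurableT mh _); last by move=> N t _; rewrite lee_fin.
apply: ae_ge0_le_integral => //.
- by move=> t _; rewrite lee_fin -expr2 sqr_ge0.
- exact: (measurable_int m (inner_integrable xL xL)).
- by move=> t _; apply: limn_einf_ge0 => N; rewrite lee_fin.
- exact: measurable_fun_limn_einf.
apply: (@filterS2 _ _ (ae_filter_ringOfSetsType m) _ _ _ _ ae_lebesgue01_co
  (average_cvg xL)) => t /= t01 xt _.
(* Only the cell containing [t] contributes to the sum [h N t]. *)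
have -> : (fun N => (h N t)%:E) = EFin \o (fun N => average N x t * average N x t).
  apply/funext => N /=; have [i it] := floor_co N t01.
  rewrite /h (bigD1 i) //= big1 => [|j ji].
    rewrite addr0 /u indicE cellE it eqxx mulr1 /average it expr2 //.
  move: ji; rewrite -val_eqE /= eq_sym => /negbTE ij.
  by rewrite /u indicE cellE it eqz_nat ij mulr0.
have cv : (average N x t * average N x t)%:E @[N --> \oo] --> (x t * x t)%:E.
  by apply: cvg_EFin; [exact: nearW|exact: cvgM].
by rewrite (cvg_limn_einf_sup cv).
Qed.

Lemma limn_einf_energy x : x \in L2fun ->
  limn_einf (fun N => (energy N x)%:E) = (inner x x)%:E.
Proof.
move=> xL; apply/eqP; rewrite eq_le inner_le_limn_einf_energy // andbT.
by apply: limn_einf_le => N; rewrite lee_fin energy_le.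
Qed.

End energy_limit.

(** * Measurability and second moments of random functions *)

Section random_elements.
Context {dO : measure_display} {Omega : measurableType dO} {R : realType}.
Variable P : probability Omega R.
Local Notation m := (@lebesgue01 R).
Local Notation L2fun := (Lfun m 2%:E).
Implicit Types (X Y : Omega -> R -> R).

(** Makes inner products with a fixed function Borel measurable, since the rays ]a, +oo[ generate
    the Borel sets of the line. *)
Lemma L2_open_inner_gt (a : R) (e : R -> R) : e \in L2fun ->
  L2_open [set g : L2 R | a < inner g e].
Proof.
move=> eL f /= af.
pose D := inner f e - a; have D0 : 0 < D by rewrite subr_gt0.
(* With u = g - f, the radius and [L] make both L^2 |u|^2 and |e|^2 smaller than L D, so that |L u +
   e|^2 >= 0 forces <u, e> > - D. The added 1 keeps [L] positive and the second bound strict. *)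
pose L := (inner e e + 1) / D.
have L0 : 0 < L.
  by apply: divr_gt0 => //; apply: ltr_wpDl => //; exact: inner_ge0.
exists (Num.sqrt (D / L)).
  by rewrite sqrtr_gt0; exact: divr_gt0.
move=> g; rewrite /hnorm ltr_sqrt => [gf|]; last exact: divr_gt0.
have uL := LfunB (L2_Lfun g) (L2_Lfun f).
have := inner_ge0 (fun t => L * (g \- f) t + e t).
rewrite inner_sqrD // (innerBl _ _ eL) ?L2_Lfun // => h.
have gfL : L * (L * inner (g \- f) (g \- f)) < L * D.
  by rewrite ltr_pM2l // mulrC -ltr_pdivlMr.
have eD : inner e e < L * D by rewrite /L divfK ?gt_eqF // ltrDl.
have : 0 < 2 * L * (inner g e - inner f e + D) by lra.
by rewrite (pmulr_rgt0 _ (mulr_gt0 _ L0)) //= /D => *; lra.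
Qed.

Lemma measurable_inner (X : Omega -> L2 R) (e : R -> R) : e \in L2fun ->
  (forall A : set (L2 R), L2_borel A -> measurable (X @^-1` A)) ->
  measurable_fun setT (fun w => inner (X w) e).
Proof.
move=> eL mX.
apply: (measurability _ (RGenOInfty.measurableE R)) => /= _ [_ [a ->] <-].
rewrite setTI.
rewrite (_ : _ @^-1` _ = X @^-1` [set g : L2 R | a < inner g e]); last first.
  by apply/seteqP; split => w /=; rewrite in_itv /= andbT.
by apply: mX; apply: sub_gen_smallest; exact: L2_open_inner_gt.
Qed.

(** [X] takes plain functions as values, since differences of elements of [L2] are such. Scalar
    measurability is stable under sums and yields that of norms. *)
Definition weakly_measurable X := (forall w, X w \in L2fun) /\
  forall e, e \in L2fun -> measurable_fun setT (fun w => inner (X w) e).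

Lemma measurable_energy X N : weakly_measurable X ->
  measurable_fun setT (fun w => (energy N (X w))%:E).
Proof.
move=> [XL mX]; apply/measurable_EFinP.
apply: measurable_sum => i; apply: measurable_funM => //.
apply: measurable_funX; apply: mX; apply: Lfun_indic; exact: measurable_cell.
Qed.

(** The squared norm is the limit inferior of the energies, which are finite combinations of squares
    of measurable inner products. *)
Lemma measurable_inner_sqr X : weakly_measurable X ->
  measurable_fun setT (fun w => (inner (X w) (X w))%:E).
Proof.
move=> wX; rewrite (_ : (fun w => _) =
  fun w => limn_einf (fun N => (energy N (X w))%:E)).
  by apply: measurable_fun_limn_einf => N; exact: measurable_energy.
by apply/funext => w; rewrite limn_einf_energy //; case: wX.
Qed.

Lemma weakly_measurableD X Y : weakly_measurable X -> weakly_measurable Y ->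
  weakly_measurable (fun w => X w \+ Y w).
Proof.
move=> [XL mX] [YL mY]; split=> [w|e eL]; first exact: LfunD.
under eq_fun do rewrite innerDl //.
by apply: measurable_funD; [exact: mX|exact: mY].
Qed.

(** Polarization reduces this to squared norms. *)
Lemma measurable_inner2 X Y : weakly_measurable X -> weakly_measurable Y ->
  measurable_fun setT (fun w => inner (X w) (Y w)).
Proof.
move=> wX wY; have wXY := weakly_measurableD wX wY.
have [XL _] := wX; have [YL _] := wY.
rewrite (_ : (fun w => _) = fun w => 2^-1 * (inner (X w \+ Y w) (X w \+ Y w) -
  inner (X w) (X w) - inner (Y w) (Y w))).
  apply: measurable_funM => //; apply: measurable_funB.
    by apply: measurable_funB; apply/measurable_EFinP; exact: measurable_inner_sqr.
  by apply/measurable_EFinP; exact: measurable_inner_sqr.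
apply/funext => w.
have XYL := LfunD (XL w) (YL w).
rewrite innerDl // !(innerC _ (_ \+ _)) !innerDl // (innerC (Y w) (X w)); lra.
Qed.

Lemma integral_energy X N : weakly_measurable X ->
  (\int[P]_w (energy N (X w))%:E = \sum_(i < N.+1)
    N.+1%:R%:E * \int[P]_w (inner (X w) \1_(cell N i%:Z) ^+ 2)%:E)%E.
Proof.
move=> [XL mX].
have mXi (i : 'I_N.+1) : measurable_fun setT
    (fun w => (inner (X w) \1_(cell N i%:Z) ^+ 2)%:E).
  apply/measurable_EFinP/measurable_funX/mX.
  by apply: Lfun_indic; exact: measurable_cell.
under eq_integral => w _ do rewrite /energy -sumEFin.
rewrite ge0_integral_sum // => [|i|i w _].
- apply: eq_bigr => i _; under eq_integral do rewrite EFinM.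
  by rewrite ge0_integralZl // => w _; rewrite lee_fin sqr_ge0.
- under eq_fun do rewrite EFinM.
  exact: measurable_funeM.
- by rewrite lee_fin mulr_ge0 // sqr_ge0.
Qed.

(** By Fatou's lemma E|X|^2 is at most the limit inferior of the expected energies of [X]. These
    equal those of [Y], each at most E|Y|^2. *)
Lemma le_expectation_inner_sqr X Y :
  weakly_measurable X -> weakly_measurable Y ->
  (forall A, measurable A -> 'E_P[fun w => (inner (X w) \1_A ^+ 2)%R] =
                             'E_P[fun w => (inner (Y w) \1_A ^+ 2)%R])%E ->
  ('E_P[fun w => inner (X w) (X w)] <= 'E_P[fun w => inner (Y w) (Y w)])%E.
Proof.
move=> wX wY XY; rewrite unlock.
under eq_integral => w _ do rewrite -(limn_einf_energy (wX.1 w)).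
apply: le_trans (fatou P measurableT (fun N => measurable_energy N wX) _) _.
  move=> N w _; rewrite lee_fin; apply: sumr_ge0 => i _.
  by rewrite mulr_ge0 // sqr_ge0.
apply: limn_einf_le => N.
apply: (@le_trans _ _ (\int[P]_w (energy N (Y w))%:E)%E).
  rewrite !integral_energy // le_eqVlt; apply/orP; left; apply/eqP.
  apply: eq_bigr => i _; congr (_ * _)%E.
  by have := XY _ (measurable_cell N i%:Z); rewrite unlock.
apply: ge0_le_integral => //.
- move=> w _; rewrite lee_fin; apply: sumr_ge0 => i _.
  by rewrite mulr_ge0 // sqr_ge0.
- exact: measurable_energy.
- exact: measurable_inner_sqr.
by move=> w _; rewrite lee_fin energy_le //; exact: wY.1.
Qed.

Lemma fine_expectation_inner_le X Y (T : R) :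
  weakly_measurable X -> weakly_measurable Y ->
  'E_P[fun w => inner (X w) (X w)]%E = T%:E ->
  'E_P[fun w => inner (Y w) (Y w)]%E = T%:E ->
  fine 'E_P[fun w => inner (X w) (Y w)]%E <= T.
Proof.
move=> wX wY; rewrite unlock => XT YT.
have [XL _] := wX; have [YL _] := wY.
have iZ Z : weakly_measurable Z -> (\int[P]_w (inner (Z w) (Z w))%:E)%E = T%:E ->
    P.-integrable setT (fun w => (2^-1 * inner (Z w) (Z w))%:E).
  move=> wZ ZT.
  suff iz : P.-integrable setT (fun w => (inner (Z w) (Z w))%:E).
    exact: (integrableZl measurableT 2^-1 iz).
  apply/integrableP; split; first exact: measurable_inner_sqr.
  under eq_integral => w _ do rewrite gee0_abs ?lee_fin ?inner_ge0 //.
  by rewrite ZT ltry.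
have iXY := integrableD measurableT (iZ _ wX XT) (iZ _ wY YT).
(* The two signs come from |a X + Y|^2 >= 0 with a = 1 and a = -1. Bounding the absolute value also
   gives integrability. *)
have bound w : `|inner (X w) (Y w)| <=
    2^-1 * inner (X w) (X w) + 2^-1 * inner (Y w) (Y w).
  have p a := inner_sqrD a (XL w) (YL w).
  have := inner_ge0 (fun t => 1 * X w t + Y w t).
  have := inner_ge0 (fun t => -1 * X w t + Y w t).
  by rewrite !p ler_norml => *; apply/andP; split; lra.
have ixy : P.-integrable setT (fun w => (inner (X w) (Y w))%:E).
  apply: le_integrable iXY => //.
    by apply/measurable_EFinP; exact: measurable_inner2.
  move=> w _ /=; rewrite lee_fin; apply: le_trans (bound w) _.
  exact: ler_norm.
rewrite -lee_fin fineK; last exact: integrable_fin_num.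
apply: le_trans (le_integral measurableT ixy iXY _) _.
  by move=> w _; rewrite lee_fin; apply: le_trans (bound w); exact: ler_norm.
rewrite integralD //; [|exact: iZ..].
under eq_integral => w _ do rewrite EFinM.
under [X in (_ + X)%E]eq_integral => w _ do rewrite EFinM.
rewrite !ge0_integralZl ?lee_fin ?invr_ge0 //.
- by rewrite XT YT -!EFinM -EFinD lee_fin; lra.
- exact: measurable_inner_sqr.
- by move=> w _; rewrite lee_fin inner_ge0.
- exact: measurable_inner_sqr.
- by move=> w _; rewrite lee_fin inner_ge0.
Qed.

End random_elements.

(** * The trace-covariogram of an isotropic field *)

Section isotropic_field.
Context {R : realType} {dO : measure_display} {Omega : measurableType dO}.
Variables (P : probability Omega R) (d : nat).
Variables (chi : 'rV[R]_d -> Omega -> L2 R) (mu : 'rV[R]_d -> L2 R).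
Variable C : 'rV[R]_d -> 'rV[R]_d -> L2 R -> L2 R.
Hypothesis chi_field : functional_random_field chi.
Hypothesis chi_C : covariance_operators P chi mu C.
Hypothesis chi_iso : isotropic P chi mu C.
Local Notation tc := (trace_covariogram P chi mu).
Local Notation sigma := (sigma_tr P chi mu).

Lemma enorm0 : enorm (0 : 'rV[R]_d) = 0.
Proof.
rewrite /enorm big1 ?sqrtr0 // => i _.
by rewrite mxE expr0n.
Qed.

Lemma enorm_eq0 (x : 'rV[R]_d) : enorm x = 0 -> x = 0.
Proof.
move=> /eqP; rewrite sqrtr_eq0 => x0; apply/rowP => i; rewrite mxE.
have /eqP : \sum_(i < d) x ord0 i ^+ 2 = 0.
  by apply/eqP; rewrite eq_le x0 sumr_ge0 // => j _; rewrite sqr_ge0.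
rewrite psumr_eq0 => [/allP/(_ i)|j _]; last by rewrite sqr_ge0.
by rewrite mem_index_enum sqrf_eq0 => /(_ isT)/eqP.
Qed.

Lemma weakly_measurable_centered s :
  weakly_measurable (fun w => centered chi mu s w).
Proof.
split=> [w|e eL]; first by apply: LfunB; exact: L2_Lfun.
under eq_fun do rewrite innerBl ?L2_Lfun //.
by apply: measurable_funB => //; apply: measurable_inner => //; exact: chi_field.
Qed.

(** Since s - s = 0 for every s, isotropy makes [C s s] constant, and <C s s e, e> is the second
    moment of the inner product with e. The comparison of squared norms is used in both
    directions. *)
Lemma expectation_inner_sqr_eq s s' :
  'E_P[fun w => inner (centered chi mu s w) (centered chi mu s w)]%E =
  'E_P[fun w => inner (centered chi mu s' w) (centered chi mu s' w)]%E.
Proof.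
have Css r r' : C r r = C r' r'.
  by apply: chi_iso.2; rewrite !subrr.
have le r r' : ('E_P[fun w => inner (centered chi mu r w) (centered chi mu r w)] <=
  'E_P[fun w => inner (centered chi mu r' w) (centered chi mu r' w)])%E.
  apply: le_expectation_inner_sqr; do ? exact: weakly_measurable_centered.
  move=> A mA.
  have [e eA] := L2_repr (Lfun_indic mA).
  have moment q : 'E_P[fun w => (inner (centered chi mu q w) \1_A ^+ 2)%R]%E =
      (inner (C q q e) e)%:E.
    rewrite -chi_C; congr ('E_P[_])%E; apply/funext => w.
    have cL := (weakly_measurable_centered q).1 w.
    rewrite innerZl ?L2_Lfun // -expr2.
    by rewrite (inner_ae (L2_Lfun e) (Lfun_indic mA) cL eA).
  by rewrite !moment (Css r r').
by apply/eqP; rewrite eq_le !le.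
Qed.

(** A pair at distance 0 consists of twice the same location, and all such pairs give the same
    value, whichever [xget] selects. *)
Lemma sigma_tr0 s : sigma 0 = tc s s.
Proof.
have tcs r : tc r r = tc s s.
  by rewrite /trace_covariogram (expectation_inner_sqr_eq r s).
rewrite /sigma_tr; case: xgetP => [_ -> [s1 [s2 [/enorm_eq0/eqP]]]|].
  by rewrite subr_eq0 => /eqP <- ->.
by move=> /(_ (tc s s)) []; exists s, s; rewrite subrr enorm0.
Qed.

Lemma sigma_tr_le h : 0 < sigma 0 -> sigma h <= sigma 0.
Proof.
move=> s0; rewrite {1}/sigma_tr.
(* If no pair is at distance [h], the value is the default 0. *)
case: xgetP => [_ -> [s1 [s2 [_ ->]]]|_]; last exact: ltW.
have second r : 'E_P[fun w => inner (centered chi mu r w) (centered chi mu r w)]%E =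
    (sigma 0)%:E.
  rewrite (sigma_tr0 r) /trace_covariogram fineK //.
  (* [fine] sends infinite values to 0, so positivity forces the expectation to be finite. *)
  move: s0; rewrite (sigma_tr0 r) /trace_covariogram.
  by case: ('E_P[_])%E => //=; rewrite ltxx.
by apply: fine_expectation_inner_le => //; exact: weakly_measurable_centered.
Qed.

End isotropic_field.

(** * Bounds on the effective sample size *)

Theorem proposition3p1 (R : realType) (dO : measure_display)
    (Omega : measurableType dO) (P : probability Omega R) (d n : nat)
    (chi : 'rV[R]_d -> Omega -> L2 R) (mu : 'rV[R]_d -> L2 R)
    (C : 'rV[R]_d -> 'rV[R]_d -> L2 R -> L2 R) (s : 'I_n -> 'rV[R]_d) :
  (1 <= n)%N ->
  functional_random_field chi ->
  mean_functions P chi mu ->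
  covariance_operators P chi mu C ->
  isotropic P chi mu C ->
  0 < sigma_tr P chi mu 0 ->
  (forall h : R, 0 <= h -> 0 <= sigma_tr P chi mu h) ->
  1 <= ESS P chi mu s <= n%:R.
Proof.
move=> n0 mchi _ chiC iso s0 s_ge0; rewrite /ESS.
set sigma := sigma_tr P chi mu in s0 s_ge0 *.
have nR : 0 < n%:R :> R by rewrite ltr0n.
set S := \sum_(i < n) _.
have Sle : S <= n%:R ^+ 2 * sigma 0.
  apply: (@le_trans _ _ (\sum_(i < n) \sum_(j < n) sigma 0)).
    apply: ler_sum => i _; apply: ler_sum => j _.
    exact: (sigma_tr_le mchi chiC iso _ s0).
  by rewrite !sumr_const !card_ord -mulrnA -[leLHS]mulr_natl natrM expr2.
have Sge : n%:R * sigma 0 <= S.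
  rewrite mulr_natl -[n in _ *+ n]card_ord -sumr_const; apply: ler_sum => i _.
  rewrite (bigD1 i) //= subrr enorm0 lerDl; apply: sumr_ge0 => j _.
  by apply: s_ge0; rewrite sqrtr_ge0.
have S0 : 0 < S by apply: lt_le_trans Sge; rewrite mulr_gt0.
rewrite ler_pdivlMr // mul1r Sle /= ler_pdivrMr // expr2 -mulrA.
by rewrite ler_pM2l.
Qed.
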